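(* Let $S$ be a convex differentiable spiral with monotonic winding such that $\overline{\dim}_\mathrm{B} S>1$. Then for all $\theta \in (0,1)$ we have \[ \dim_{\mathrm{A}}^\theta S \ = \ \min\left\{\frac{\overline{\dim}_\mathrm{B} S}{1- \theta}, \ 2\right\}. \] Note that such spirals must have sub-exponential winding.
   Context: A spiral is a set $S=\{\phi(\alpha)\exp(i\alpha):\alpha\in[0,\infty)\}\cup\{0\}\subset\mathbb{C}$, where $\phi$ is a continuous decreasing real-valued function on $[0,\infty)$ with $\lim_{\alpha\to\infty}\phi(\alpha)=0$ and $\phi(0)=1$. The spiral is convex differentiable if $\phi$ is differentiable and its derivative is non-decreasing. The spiral has monotonic winding if $x\mapsto\phi(x)-\phi(x+2\pi)$ is decreasing in $x\geq0$. The winding is sub-exponential if $\frac{\log\phi(x)}{x}\to0$ as $x\to\infty$. For a subset $E$ of a metric space and $r>0$, $N(E,r)$ denotes the minimal number of balls of radius $r$ required to cover $E$, and $B(x,R)$ is the ball of radius $R$ centred at $x$. For $\theta\in(0,1)$, the Assouad spectrum of $F$ at $\theta$ is \[ \dim_{\mathrm A}^{\theta} F = \inf\Big\{\alpha : \exists C>0,\ \exists \rho>0,\ \forall\, 0<R\leq\rho,\ \forall x\in F,\ N(B(x,R)\cap F,R^{1/\theta})\leq C \big(R/R^{1/\theta}\big)^{\alpha}\Big\}. \] The upper box dimension of a totally bounded set $F$ is $\overline{\dim}_{\mathrm B}F=\limsup_{R\to0}\frac{\log N(F,R)}{-\log R}$.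
   Formalization: The closing note is false if sub-exponential winding means log φ(x)/x → 0 (convex spirals with box dimension 2 exist where this ratio is near −1 along a sequence); it is proved in the corrected form limsup log φ(x)/x = 0. ''Decreasing'' is read strictly. *)

(* Defs.v *)
From HB Require Import structures.
From mathcomp Require Import all_boot all_order all_algebra.
From mathcomp Require Import all_classical all_reals all_analysis.
From mathcomp Require Import complex.
Set Implicit Arguments.
Unset Strict Implicit.
Unset Printing Implicit Defensive.
Import Order.TTheory GRing.Theory Num.Theory.
Import numFieldNormedType.Exports.
Local Open Scope classical_set_scope.
Local Open Scope ring_scope.

(* [Rcomplex R] is [R[i]] with its [R]-valued modulus as norm; the library
   gives it no metric structure over [R]. *)
Section Rcomplex_metric.
Variable R : realType.
Implicit Types x y z : Rcomplex R.

Let dist x y : R := `|x - y|.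

Let distxx x : dist x x = 0.
Proof. by rewrite /dist subrr normr0. Qed.

Let dist_positivity x y : dist x y = 0 -> x = y.
Proof. by move=> /normr0_eq0/eqP; rewrite subr_eq0 => /eqP. Qed.

Let dist_sym x y : dist x y = dist y x.
Proof. exact: distrC. Qed.

Let dist_triangle y x z : dist x z <= dist x y + dist y z.
Proof. by rewrite /dist -(subrKA y x (- z)) ler_normD. Qed.

HB.instance Definition _ := isMetric.Build R (Rcomplex R)
  distxx dist_positivity dist_sym dist_triangle.

End Rcomplex_metric.

Section dimensions.
Variables (R : realType) (T : metricType R).
Implicit Types (E F : set T).

(* Equal to [+oo] when no finite cover exists. Balls are open, with centres
   anywhere in the ambient space. *)
Definition covering_number E (r : R) : \bar R :=
  ereal_inf [set n%:R%:E | n in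
    [set n : nat | exists c : 'I_n -> T, E `<=` \bigcup_i ball (c i) r]].

Definition upper_box_dim F : \bar R :=
  limf_esup (fun r : R => lne (covering_number F r) / (- ln r)%:E)%E 0^'+.

Definition assouad_spectrum (theta : R) F : \bar R :=
  ereal_inf [set a%:E | a in [set a : R |
    exists C rho : R, [/\ 0 < C, 0 < rho &
      forall (r : R) (x : T), 0 < r <= rho -> F x ->
        (covering_number (ball x r `&` F) (r `^ theta^-1)
           <= (C * (r / r `^ theta^-1) `^ a)%:E)%E]]].

End dimensions.

Section spirals.
Variable R : realType.
Implicit Types phi : R -> R.

(* [phi] is only meant as a function on [0, +oo[; its values at negative
   arguments are irrelevant everywhere below. *)
Record spiral_fun phi : Prop := SpiralFun {
  spiral_fun_continuous : {within `[0, +oo[, continuous phi} ;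
  spiral_fun_decreasing : {in `[0, +oo[ &, {homo phi : x y /~ x < y}} ;
  spiral_fun_cvg0 : phi x @[x --> +oo] --> (0 : R) ;
  spiral_fun0 : phi 0 = 1 }.

Definition spiral phi : set (Rcomplex R) :=
  [set ((phi a)%:C * (cos a +i* sin a))%C | a in `[0, +oo[] `|` [set 0].

(* The derivative at [0] is one-sided, [0] being an endpoint of the domain. *)
Definition convex_differentiable phi : Prop :=
  exists dphi : R -> R,
    (forall x, 0 <= x ->
      (phi y - phi x) / (y - x) @[y --> within `[0, +oo[ x^'] --> dphi x) /\
    {in `[0, +oo[ &, {homo dphi : x y / x <= y}}.

Definition monotonic_winding phi : Prop :=
  {in `[0, +oo[ &, {homo (fun x => phi x - phi (x + 2 * pi)) : x y /~ x < y}}.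

(* The upper limit, not the limit: convexity and upper box dimension greater
   than 1 do not make [ln (phi x) / x] converge. A smoothing of the piecewise
   linear interpolation of [expR (- x)] at nodes [x_n] growing fast enough has
   box dimension 2, while the ratio stays near [-1] at the nodes. *)
Definition limsup_subexponential_winding phi : Prop :=
  limf_esup (fun x : R => (ln (phi x) / x)%:E) (pinfty_nbhs R) = 0%E.

End spirals.

(* Main.v *)
Require Import Defs.
From HB Require Import structures.
From mathcomp Require Import all_boot all_order all_algebra.
From mathcomp Require Import all_classical all_reals all_analysis.
From mathcomp Require Import complex lra ring.
Set Implicit Arguments.
Unset Strict Implicit.
Unset Printing Implicit Defensive.
Import Order.TTheory GRing.Theory Num.Theory.
Import numFieldNormedType.Exports.
Local Open Scope ring_scope.

(** The exponent of a spiral is decided near its centre: once consecutive turns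
are closer than [s], the spiral is [s]-dense in a disc.  Write [gap x] for
[phi x - phi (x + 2 * pi)].  Since [gap] decreases, the disc of radius
[phi (x + 2 * pi)] lies within [gap x] of the spiral ([spiral_dense_core]), so
at scale [s := gap x] the part of the spiral in a disc of radius [r] about the
origin needs about [(min r (phi x) / s) ^ 2] balls ([covering_number_core]).

The work lies in showing that these discs alone account for the box dimension.
If [phi x <= C * (1 + x) `^ (- q)] with [0 < q < 1], cutting the spiral at the
angle [s `^ (- 1 / (1 + q))] and covering the outer arc by its length and the
rest by a disc gives box dimension at most [2 / (1 + q)]
([upper_box_dim_spiral_decay]).  So a dimension above [d > 1] forbids this
decay with [q = 2 / d - 1].  On the other hand, the differential inequality
[- phi' >= phi `^ (1 + 1 / q)], here in the discrete form of one step per turn,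
would force it ([decay_of_gaps]).  Hence at arbitrarily large [x] the
gap [s] is smaller than [phi x `^ (1 + 1 / q)], that is
[(phi x / s) ^ 2 > s `^ (- d)] ([small_gap]).

Take such an [s] and [r := s `^ theta].  If [phi x >= r] the whole disc of
radius [r] is filled and needs about [(r / s) ^ 2] balls; otherwise at least
[s `^ (- d) = (r / s) `^ (d / (1 - theta))] balls are needed.  This is the lower
bound for the spectrum ([assouad_spectrum_ge]).  The upper bound holds for all
planar sets of positive dimension: the covering number of a piece is at most that of the whole set,
and at most that of a full disc.

Finally, exponential decay is in particular polynomial decay, so it is
excluded too, and the upper limit of [ln (phi x) / x] vanishes. *)

(** * Covering numbers and upper box dimension *)

Section covering.
Context {R : realType} {T : metricType R}.
Implicit Types (E F : set T) (r x : R).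
Local Open Scope classical_set_scope.

(** Centres are indexed by an arbitrary finite type, so that unions and products
of covers need no renumbering, and the number of balls may be replaced by any
real upper bound. *)
Definition coverable E r x : Prop :=
  exists (I : finType) (c : I -> T),
    E `<=` \bigcup_i ball (c i) r /\ #|I|%:R <= x.

Lemma coverableU E F r x y :
  coverable E r x -> coverable F r y -> coverable (E `|` F) r (x + y).
Proof.
move=> [I [c [Ec Ix]]] [J [d [Fd Jy]]].
exists (I + J)%type, (fun k => match k with inl i => c i | inr j => d j end).
split; last by rewrite card_sum natrD lerD.
move=> z [/Ec[i _ zi]|/Fd[j _ zj]]; first by exists (inl i).
by exists (inr j).
Qed.

Lemma sub_coverable E F r x y :
  E `<=` F -> x <= y -> coverable F r x -> coverable E r y.
Proof.
move=> EF xy [I [c [Fc Ix]]]; exists I, c; split; last exact: le_trans xy.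
exact: subset_trans Fc.
Qed.

Lemma covering_number_le E r x :
  coverable E r x -> (covering_number E r <= x%:E)%E.
Proof.
move=> [I [c [Ec Ix]]]; apply: (@le_trans _ _ (#|I|%:R%:E)); last first.
  by rewrite lee_fin.
apply: ereal_inf_lbound; exists #|I| => //=; exists (fun i => c (enum_val i)).
by move=> z /Ec[i _ zi]; exists (enum_rank i) => //; rewrite enum_rankK.
Qed.

Lemma covering_number_ge E r x :
  (forall n (c : 'I_n -> T), E `<=` \bigcup_i ball (c i) r -> x <= n%:R) ->
  (x%:E <= covering_number E r)%E.
Proof.
move=> h; apply: le_ereal_inf_tmp => _ [n [c Ec] <-].
by rewrite lee_fin; exact: h Ec.
Qed.

Lemma covering_number_ge0 E r : (0 <= covering_number E r)%E.
Proof. by apply: covering_number_ge => n c _; rewrite ler0n. Qed.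

Lemma le_covering_number E F r :
  E `<=` F -> (covering_number E r <= covering_number F r)%E.
Proof.
move=> EF; apply: ereal_inf_le_tmp => _ [n [c Fc] <-]; exists n => //.
by exists c; exact: subset_trans Fc.
Qed.

(** The constant is harmless: [K <= r `^ (- e)] as soon as
[r <= K `^ (- e^-1)], which costs an arbitrarily small [e] in the exponent. *)
Lemma upper_box_dim_le F (K D : R) : 0 < K ->
  (forall r, 0 < r < 1 -> (covering_number F r <= (K * r `^ (- D))%:E)%E) ->
  (upper_box_dim F <= D%:E)%E.
Proof.
move=> K0 FK; apply/lee_addgt0Pr => e e0; rewrite -EFinD.
pose r0 := Num.min 1 (K `^ (- e^-1)).
have r00 : 0 < r0 by rewrite lt_min ltr01 powR_gt0.
have V : 0^'+ [set r : R | 0 < r < r0].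
  near=> r; apply/andP; split; first by near: r; exact: nbhs_right_gt.
  by near: r; exact: nbhs_right_lt.
apply: (@le_trans _ _ (ereal_sup
  [set (lne (covering_number F r) / (- ln r)%:E)%E | r in
    [set r : R | 0 < r < r0]])).
  by apply: ereal_inf_lbound; exists [set r : R | 0 < r < r0].
apply: ge_ereal_sup => _ [r /= /andP[r_gt0 +] <-]; rewrite lt_min => /andP[r1 rK].
have lnr : 0 < - ln r by rewrite oppr_gt0 ln_lt0// r_gt0.
rewrite inver gt_eqF// lee_pdivrMr// -EFinM.
have -> : (((D + e) * - ln r)%:E = lne ((r `^ (- (D + e)))%:E))%E.
  by rewrite lne_EFin ?powR_gt0// ln_powR mulrN mulNr.
rewrite lee_lne ?in_itv/= ?leey ?covering_number_ge0 ?lee_fin ?powR_ge0//.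
apply: (le_trans (FK _ _)); first by rewrite r_gt0.
rewrite lee_fin opprD addrC powRD; last by rewrite (gt_eqF r_gt0) implybT.
apply: ler_wpM2r; first exact: powR_ge0.
have : r `^ e <= K^-1.
  have -> : K^-1 = (K `^ (- e^-1)) `^ e.
    by rewrite -powRrM mulNr mulVf ?gt_eqF// powR_inv1 ?ltW.
  by rewrite ge0_ler_powR ?nnegrE ?powR_ge0 ?ltW.
by rewrite powRN -[leLHS]invrK lef_pV2 ?posrE ?invr_gt0 ?powR_gt0.
Unshelve. all: by end_near. Qed.

Lemma upper_box_dim_lt F (D : R) : (upper_box_dim F < D%:E)%E ->
  exists2 r0 : R, 0 < r0 &
    forall r, 0 < r < r0 -> (covering_number F r <= (r `^ (- D))%:E)%E.
Proof.
move=> /ereal_inf_lt[_ [V V0 <-] VD].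
have [e /= e0 eV] : 0^'+ V := V0.
exists (Num.min 1 e) => [|r /andP[r0]]; first by rewrite lt_min ltr01.
rewrite lt_min => /andP[r1 re].
have Vr : V r by apply: eV => //=; rewrite sub0r normrN gtr0_norm.
have : (lne (covering_number F r) / (- ln r)%:E <= D%:E)%E.
  by apply/ltW/(le_lt_trans _ VD)/ereal_sup_ubound; exists r.
have lnr : 0 < - ln r by rewrite oppr_gt0 ln_lt0// r0.
rewrite inver gt_eqF// lee_pdivrMr// -EFinM.
have -> : ((D * - ln r)%:E = lne ((r `^ (- D))%:E))%E.
  by rewrite lne_EFin ?powR_gt0// ln_powR mulrN mulNr.
by rewrite lee_lne ?in_itv/= ?leey ?covering_number_ge0 ?lee_fin ?powR_ge0.
Qed.
End covering.

Section control.
Context {R : realType} {T : metricType R}.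
Local Open Scope classical_set_scope.

(** Rectification without arc length: [Phi] plays the role of a length
parameter, and the slices are taken in its range, so that they have size [s]
whatever the regularity of [f], and one centre per nonempty slice is enough. *)
Lemma coverable_controlled (A : set R) (f : R -> T) (Phi : R -> R) (L s : R) :
  0 < s -> 0 <= L -> (forall x, A x -> 0 <= Phi x <= L) ->
  (forall x y, A x -> A y -> `|Phi x - Phi y| < s -> ball (f x) s (f y)) ->
  coverable (f @` A) s (L / s + 1).
Proof.
move=> s0 L0 PhiL fPhi.
pose m := (Num.truncn (L / s)).+1.
pose slice (i : nat) := [set x : R | A x /\ Num.truncn (Phi x / s) = i].
exists 'I_m, (fun i : 'I_m => f (xget 0 (slice i))); split; last first.
  by rewrite card_ord -natr1 lerD2r truncn_le divr_ge0// ltW.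
move=> _ [x Ax <-]; have /andP[Phi0 PhiL_x] := PhiL x Ax.
have im : (Num.truncn (Phi x / s) < m)%N.
  by rewrite ltnS; apply: le_truncn; rewrite ler_pM2r ?invr_gt0.
exists (Ordinal im) => //=; set p := xget _ _.
have [Ap px] : slice (Num.truncn (Phi x / s)) p by apply: xgetPex; exists x.
have /andP[Phi0p _] := PhiL p Ap; apply: fPhi => //.
have := truncn_itv (divr_ge0 Phi0 (ltW s0)).
have := truncn_itv (divr_ge0 Phi0p (ltW s0)).
rewrite px !ler_pdivlMr// !ltr_pdivrMr// -natr1 mulrDl mul1r.
by move=> /andP[? ?] /andP[? ?]; rewrite ltr_norml; apply/andP; split; lra.
Qed.
End control.

(** * Coverings of planar sets *)

Section plane.
Context {R : realType}.
Implicit Types (z w : Rcomplex R) (r s t : R).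
Local Open Scope classical_set_scope.

(** Typed in [Rcomplex R] because [R[i]] itself carries a complex-valued norm. *)
Definition cplx (a b : R) : Rcomplex R := (a +i* b)%C.

Lemma cplx_Re_Im z : z = cplx (complex.Re z) (complex.Im z).
Proof. by case: z. Qed.

Lemma ball_Rcomplex z r : ball z r = [set w : Rcomplex R | `|z - w| < r].
Proof. by []. Qed.

Lemma norm_cplx (a b : R) : `|cplx a b| = Num.sqrt (a ^+ 2 + b ^+ 2).
Proof. by []. Qed.

Lemma cplxB (a b c d : R) : cplx a b - cplx c d = cplx (a - c) (b - d).
Proof. by []. Qed.

Lemma cplxD (a b c d : R) : cplx a b + cplx c d = cplx (a + c) (b + d).
Proof. by []. Qed.

Lemma norm_cplx_le (a b : R) : `|cplx a b| <= `|a| + `|b|.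
Proof.
rewrite norm_cplx -[leRHS]ger0_norm ?addr_ge0// -sqrtr_sqr ler_sqrt ?sqr_ge0//.
rewrite sqrrD !real_normK ?num_real// lerD2r lerDl.
by rewrite mulrn_wge0// mulr_ge0.
Qed.

Lemma norm_polar (r a : R) : `|cplx (r * cos a) (r * sin a)| = `|r|.
Proof. by rewrite norm_cplx !exprMn -mulrDr cos2Dsin2 mulr1 sqrtr_sqr. Qed.

Lemma norm_Re_le (a b : R) : `|a| <= `|cplx a b|.
Proof. by rewrite norm_cplx -sqrtr_sqr ler_wsqrtr// lerDl sqr_ge0. Qed.

Lemma norm_Im_le (a b : R) : `|b| <= `|cplx a b|.
Proof. by rewrite norm_cplx -sqrtr_sqr ler_wsqrtr// lerDr sqr_ge0. Qed.

(** A square grid of mesh [s / 2] spanning the square around the ball: in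
each cell both coordinates are within [s / 2] of those of the corner.  Its side has at most
[4 * r / s + 1 <= 5 * (r / s)] cells. *)
Lemma coverable_ball z r s : 0 < s -> s <= r ->
  coverable (ball z r) s (25 * (r / s) ^+ 2).
Proof.
move=> s0 sr; have r0 : 0 < r := lt_le_trans s0 sr.
pose m := (Num.truncn (4 * r / s)).+1.
pose corner : Rcomplex R := z - cplx r r.
exists ('I_m * 'I_m)%type,
  (fun ij : 'I_m * 'I_m => corner + cplx (ij.1%:R * (s / 2)) (ij.2%:R * (s / 2))).
have m_le : m%:R <= 5 * (r / s).
  have : 1 <= r / s by rewrite ler_pdivlMr// mul1r.
  have : (Num.truncn (4 * r / s))%:R <= 4 * r / s.
    by rewrite truncn_le// divr_ge0 ?mulr_ge0 ?ltW.
  by rewrite /m -natr1 -mulrA; lra.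
split; last first.
  rewrite card_prod !card_ord natrM -expr2.
  by rewrite (_ : 25 * _ = (5 * (r / s)) ^+ 2); [rewrite lerXn2r ?nnegrE//|ring];
     rewrite mulr_ge0// divr_ge0 ?ltW.
have cell (x : R) : `|x| < r -> exists i : 'I_m, `|x + r - i%:R * (s / 2)| < s / 2.
  rewrite ltr_norml => /andP[rx xr].
  have y0 : 0 <= (x + r) / (s / 2) by rewrite divr_ge0 ?divr_ge0 ?ltW//; lra.
  have /andP[] := truncn_itv y0; set i := Num.truncn _ => iy yi.
  have im : (i < m)%N.
    rewrite ltnS /i; apply: le_truncn.
    rewrite invf_div mulrA ler_pM2r ?invr_gt0//; lra.
  exists (Ordinal im) => /=; move: iy yi.
  rewrite ler_pdivlMr ?divr_gt0// ltr_pdivrMr ?divr_gt0// -(natr1 i) mulrDl mul1r.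
  by move=> iy yi; rewrite ltr_norml; apply/andP; split; lra.
move=> w; rewrite ball_Rcomplex /= /corner.
rewrite (cplx_Re_Im z) (cplx_Re_Im w) cplxB.
set a := complex.Re z; set b := complex.Im z.
set c := complex.Re w; set d := complex.Im w => zw.
have [i hi] : exists i : 'I_m, `|c - a + r - i%:R * (s / 2)| < s / 2.
  by apply: cell; rewrite distrC; exact: le_lt_trans (norm_Re_le _ _) zw.
have [j hj] : exists j : 'I_m, `|d - b + r - j%:R * (s / 2)| < s / 2.
  by apply: cell; rewrite distrC; exact: le_lt_trans (norm_Im_le _ _) zw.
exists (i, j) => //=; rewrite ball_Rcomplex /= cplxB cplxD cplxB /=.
apply: (le_lt_trans (norm_cplx_le _ _)).
rewrite [ltRHS](splitr s) ltrD// distrC.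
- by rewrite (_ : _ - _ = c - a + r - i%:R * (s / 2))//; ring.
- by rewrite (_ : _ - _ = d - b + r - j%:R * (s / 2))//; ring.
Qed.

(** Pigeonhole on the square grid of mesh [5 * s]: each grid point is within [s]
of [E], hence within [2 * s] of the centre of some ball, and two grid points
sharing that centre would be closer than [4 * s].  The grid must lie inside the
open disc of radius [r]; a side of [5 / 11 * r] achieves it. *)
Lemma covering_number_dense (E : set (Rcomplex R)) r s : 0 <= r -> 0 < s ->
  (forall z, `|z| < r -> exists2 w, E w & `|z - w| <= s) ->
  ((121^-1 * (r / s) ^+ 2)%:E <= covering_number E s)%E.
Proof.
move=> r0 s0 dense; apply: covering_number_ge => n c Ec.
have [->|rN0] := eqVneq r 0; first by rewrite mul0r expr0n/= mulr0.
have {}r0 : 0 < r by rewrite lt_neqAle eq_sym rN0.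
pose m := (Num.truncn (r / (11 * s))).+1.
have s11 : 0 < 11 * s by rewrite mulr_gt0.
have m_gt : r / (11 * s) < m%:R by exact: truncnS_gt.
pose grid (ij : 'I_m * 'I_m) := cplx (ij.1%:R * (5 * s)) (ij.2%:R * (5 * s)).
have side (i : 'I_m) : i%:R * (5 * s) <= 5 / 11 * r.
  have : (i%:R : R) <= r / (11 * s).
    apply: (@le_trans _ _ (Num.truncn (r / (11 * s)))%:R).
      by rewrite ler_nat -ltnS.
    by rewrite truncn_le// divr_ge0 ?ltW.
  by rewrite ler_pdivlMr//; lra.
have near_grid ij : exists k : 'I_n, `|c k - grid ij| < 2 * s.
  have [|w Ew zw] := dense (grid ij).
    apply: (le_lt_trans (norm_cplx_le _ _)).
    have g0 (i : 'I_m) : 0 <= i%:R * (5 * s) by rewrite !mulr_ge0// ltW.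
    rewrite !ger0_norm//.
    by have := side ij.1; have := side ij.2; lra.
  have [k _] := Ec w Ew; rewrite ball_Rcomplex /= => kw; exists k.
  have := ler_distD w (c k) (grid ij); rewrite (distrC w) => h.
  by apply: (le_lt_trans h); lra.
have [f fP] := choice near_grid.
have sep (i j : nat) : `|i%:R * (5 * s) - j%:R * (5 * s)| < 4 * s -> i = j.
  move=> + ; rewrite -mulrBl normrM [`|5 * s|]gtr0_norm ?mulr_gt0// => h.
  have {}h : `|i%:R - j%:R : R| < 1.
    rewrite -(ltr_pM2r (_ : 0 < 5 * s)) ?mulr_gt0//; apply: (lt_trans h); lra.
  apply/eqP; rewrite eqn_leq; move: h; rewrite ltr_norml => /andP[h1 h2].
  rewrite -ltnS -(ltnS j) -!(ltr_nat R) -!natr1.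
  by apply/andP; split; lra.
have f_inj : injective f.
  move=> [i j] [i' j'] fij.
  have : `|grid (i, j) - grid (i', j')| < 4 * s.
    have := fP (i, j); have := fP (i', j'); rewrite fij => h1 h2.
    have := ler_distD (c (f (i', j'))) (grid (i, j)) (grid (i', j')).
    by rewrite (distrC (grid (i, j)) (c _)) => h3; apply: (le_lt_trans h3); lra.
  rewrite /grid cplxB /= => h.
  have := le_lt_trans (norm_Re_le _ _) h => /sep /val_inj ->.
  by have := le_lt_trans (norm_Im_le _ _) h => /sep /val_inj ->.
have := leq_card f f_inj; rewrite card_prod !card_ord => mn.
apply: (@le_trans _ _ (m * m)%:R); last by rewrite ler_nat.
rewrite natrM -expr2.
have -> : 121^-1 * (r / s) ^+ 2 = (r / (11 * s)) ^+ 2.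
  by field; rewrite gt_eqF.
by rewrite lerXn2r ?nnegrE ?divr_ge0 ?ler0n// ltW.
Qed.
End plane.

(** * Upper bounds for the Assouad spectrum *)

Section assouad_upper_bounds.
Context {R : realType}.
Local Open Scope classical_set_scope.

(** The covering number of the whole set is used for each of its pieces: at scale
[r `^ theta^-1] it is about [r `^ (- D / theta)], and [- D / theta] is
[(1 - theta^-1) * (D / (1 - theta))]. *)
Lemma assouad_spectrum_le_box {T : metricType R} (F : set T) (theta : R) :
  0 < theta < 1 -> (0 < upper_box_dim F)%E ->
  (assouad_spectrum theta F <= upper_box_dim F / (1 - theta)%:E)%E.
Proof.
move=> /andP[t0 t1] D0; have t1' : 0 < 1 - theta by rewrite subr_gt0.
rewrite inver gt_eqF//.
have [dimy|dimNy] := eqVneq (upper_box_dim F) +oo%E.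
  by rewrite dimy gt0_mulye ?leey// lte_fin invr_gt0.
have [D DE] : exists D : R, upper_box_dim F = D%:E.
  exists (fine (upper_box_dim F)).
  by rewrite fineK// fin_numE dimNy andbT gt_eqF//
     (lt_trans _ D0)// ltNy0.
apply/lee_addgt0Pr => e e0; rewrite DE -EFinM -EFinD.
pose a := D / (1 - theta) + e.
have Da : (upper_box_dim F < (a * (1 - theta))%:E)%E.
  rewrite DE lte_fin /a mulrDl divfK ?gt_eqF// ltrDl mulr_gt0//.
have [r0 r00 HN] := upper_box_dim_lt Da.
apply: ereal_inf_lbound; exists a => //; exists 1, ((r0 / 2) `^ theta); split=> //.
  by rewrite powR_gt0// divr_gt0.
move=> r x /andP[r_gt0 r_le] Fx; rewrite mul1r.
have small : 0 < r `^ theta^-1 < r0.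
  rewrite powR_gt0//=; apply: (@le_lt_trans _ _ (r0 / 2)); last by lra.
  have -> : r0 / 2 = ((r0 / 2) `^ theta) `^ theta^-1.
    by rewrite -powRrM mulfV ?gt_eqF// powRr1// divr_ge0// ltW.
  by rewrite ge0_ler_powR ?nnegrE ?powR_ge0 ?invr_ge0 ?(ltW r_gt0) ?(ltW t0).
apply: (@le_trans _ _ (covering_number F (r `^ theta^-1))).
  by apply: le_covering_number; exact: subIsetr.
apply: (le_trans (HN _ small)); rewrite lee_fin.
rewrite -{2}(powRr1 (ltW r_gt0)) -powRB ?(gt_eqF r_gt0) ?implybT// -!powRrM.
rewrite (_ : theta^-1 * - (a * (1 - theta)) = (1 - theta^-1) * a)//.
by field; rewrite gt_eqF.
Qed.

Lemma assouad_spectrum_le2 (F : set (Rcomplex R)) (theta : R) :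
  0 < theta < 1 -> (assouad_spectrum theta F <= 2%:E)%E.
Proof.
move=> /andP[t0 t1]; apply: ereal_inf_lbound; exists 2 => //.
exists 25, 1; split=> // r z /andP[r0 r1] _.
rewrite powR_mulrn ?divr_ge0 ?powR_ge0 ?(ltW r0)//.
apply: (le_trans (le_covering_number _ (@subIsetl _ _ _))).
apply/covering_number_le/coverable_ball; first by rewrite powR_gt0.
by apply: ge1r_powR; rewrite ?r0 ?r1// invf_ge1// ltW.
Qed.

End assouad_upper_bounds.

(** * Lipschitz bounds, periodicity and polar form *)

Section trigonometry.
Context {R : realType}.
Implicit Types a b : R.

Lemma cos_lipschitz a b : a <= b -> `|cos b - cos a| <= b - a.
Proof.
rewrite le_eqVlt => /orP[/eqP ->|ab]; first by rewrite !subrr normr0.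
have [|c _ ->] := MVT ab (fun x _ => is_derive_cos x).
  exact/continuous_subspaceT/continuous_cos.
rewrite normrM normrN [`|b - a|]gtr0_norm ?subr_gt0//.
by rewrite ler_piMl ?sin_max// subr_ge0 ltW.
Qed.

Lemma sin_lipschitz a b : a <= b -> `|sin b - sin a| <= b - a.
Proof.
rewrite le_eqVlt => /orP[/eqP ->|ab]; first by rewrite !subrr normr0.
have [|c _ ->] := MVT ab (fun x _ => is_derive_sin x).
  exact/continuous_subspaceT/continuous_sin.
rewrite normrM [`|b - a|]gtr0_norm ?subr_gt0//.
by rewrite ler_piMl ?cos_max// subr_ge0 ltW.
Qed.

Lemma cosD2piMn a n : cos (a + 2 * pi * n%:R) = cos a.
Proof.
elim: n => [|n IH]; first by rewrite mulr0 addr0.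
by rewrite -(natr1 n) mulrDr mulr1 addrA; move: IH; rewrite mulr_natl cosD2pi.
Qed.

Lemma sinD2piMn a n : sin (a + 2 * pi * n%:R) = sin a.
Proof.
elim: n => [|n IH]; first by rewrite mulr0 addr0.
by rewrite -(natr1 n) mulrDr mulr1 addrA; move: IH; rewrite mulr_natl sinD2pi.
Qed.

(** [acos] only reaches the upper half plane; the lower one is obtained by
the reflection [b |-> 2 * pi - b]. *)
Lemma polar_form (z : Rcomplex R) :
  exists2 b, 0 <= b <= 2 * pi & z = cplx (`|z| * cos b) (`|z| * sin b).
Proof.
have [->|z0] := eqVneq z 0.
  exists 0; first by rewrite lexx mulr_ge0// pi_ge0.
  by rewrite normr0 !mul0r.
have nz : 0 < `|z| by rewrite normr_gt0.
move: nz; rewrite (cplx_Re_Im z).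
set x := complex.Re z; set y := complex.Im z; set r := `|_| => r0.
have rE : r ^+ 2 = x ^+ 2 + y ^+ 2.
  by rewrite /r norm_cplx sqr_sqrtr// addr_ge0// sqr_ge0.
have xr : -1 <= x / r <= 1.
  by rewrite -ler_norml normrM normfV (gtr0_norm r0) ler_pdivrMr// mul1r
             norm_Re_le.
have cosE : r * cos (acos (x / r)) = x by rewrite acosK// mulrC divfK// gt_eqF.
have sinE : r * sin (acos (x / r)) = `|y|.
  have yE : y ^+ 2 = r ^+ 2 * (1 - (x / r) ^+ 2).
    rewrite mulrBr mulr1 -exprMn mulrC divfK ?gt_eqF// rE; ring.
  by rewrite sin_acos// -(sqrtr_sqr y) yE sqrtrM ?sqr_ge0// sqrtr_sqr gtr0_norm.
have := acos_ge0 xr; have := acos_lepi xr; move: cosE sinE.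
set b := acos _ => cosE sinE bpi b0; have pi0 := pi_gt0 R.
have [y0|y0] := leP 0 y.
  exists b; first by lra.
  by rewrite cosE sinE ger0_norm.
exists (2 * pi - b); first by lra.
rewrite addrC -[2 * pi]mulr1 (cosD2piMn _ 1) (sinD2piMn _ 1) cosN sinN.
rewrite mulrN cosE sinE.
by rewrite ltr0_norm// opprK.
Qed.
End trigonometry.

(** * Inequalities on real powers *)

Section power_functions.
Context {R : realType}.
Implicit Types u v k x y s : R.

(** Weighted AM-GM between [u] and [1], in the form of Young's inequality. *)
Lemma powR_le_chord1 u k : 0 <= u -> 0 < k < 1 -> u `^ k <= k * u + (1 - k).
Proof.
move=> u0 /andP[k0 k1]; have k1' : 0 < 1 - k by rewrite subr_gt0.
have := @conjugate_powR R (u `^ k) 1 k^-1 (1 - k)^-1 (powR_ge0 _ _) ler01.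
rewrite !invr_gt0 !invrK => /(_ k0 k1'); rewrite mulr1 powR1 mul1r.
rewrite -powRrM mulfV ?gt_eqF// powRr1// (mulrC u); apply; lra.
Qed.

(** Concavity of [x `^ k] for [0 < k < 1]: the chord is steeper than the tangent
at its right end. *)
Lemma powR_chord u v k : 0 <= u -> 0 < v -> 0 < k < 1 ->
  k * v `^ (k - 1) * (v - u) <= v `^ k - u `^ k.
Proof.
move=> u0 v0 k01; have := powR_le_chord1 (divr_ge0 u0 (ltW v0)) k01.
have -> : u `^ k = (u / v) `^ k * v `^ k.
  by rewrite -powRM ?divr_ge0 ?(ltW v0)// divfK// gt_eqF.
have /andP[k0 _] := k01; rewrite -(mulr_powRB1 (ltW v0) k0).
set w := (u / v) `^ k => hw; set z := v `^ (k - 1).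
have z0 : 0 <= z by exact: powR_ge0.
have uE : u = u / v * v by rewrite divfK// gt_eqF.
move: hw; set y := u / v in uE * => hw; rewrite uE.
have : 0 <= v * z * (k * y + (1 - k) - w).
  by rewrite mulr_ge0 ?subr_ge0// mulr_ge0// ltW.
by lra.
Qed.

(** One step of the comparison with the equation [x' = - x `^ (1 + s)], whose
solutions make [x `^ (- s)] grow linearly.  For [s >= 1] it is enough to bound
[(y / x) `^ (- s)] by [x / y >= 1 + (x - y) / x]. *)
Lemma powR_step x y s : 0 < y -> 1 <= s -> y <= x -> x `^ (1 + s) <= x - y ->
  x `^ (- s) + 1 <= y `^ (- s).
Proof.
move=> y0 s1 yx gap; have x0 : 0 < x := lt_le_trans y0 yx.
have xs0 : 0 < x `^ s by rewrite powR_gt0.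
have powxs : x `^ (1 + s) = x * x `^ s.
  by rewrite powRD ?powRr1 ?(ltW x0)// (gt_eqF x0) implybT.
have yE : y `^ (- s) = (y / x) `^ (- s) * x `^ (- s).
  by rewrite -powRM ?divr_ge0 ?(ltW y0) ?(ltW x0)// divfK// gt_eqF.
have yx1 : 0 < y / x <= 1 by rewrite divr_gt0//= ler_pdivrMr// mul1r.
have h1 : x / y <= (y / x) `^ (- s).
  apply: (@le_trans _ _ ((y / x) `^ (- 1))).
    by rewrite powR_inv1 ?invf_div// ltW// divr_gt0.
  by apply: ger_powR => //; rewrite lerN2.
have h2 : 1 + x `^ s <= x / y.
  rewrite ler_pdivlMr//; have h : y + y * x `^ s <= y + x * x `^ s.
    by rewrite lerD2l ler_wpM2r// ltW.
  by rewrite mulrDl mul1r mulrC; rewrite powxs in gap; lra.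
rewrite yE; apply: (@le_trans _ _ ((1 + x `^ s) * x `^ (- s))).
  by rewrite mulrDl mul1r powRN mulfV ?gt_eqF.
by rewrite ler_wpM2r ?powR_ge0// (le_trans h2).
Qed.

End power_functions.

(** * Spirals of polynomial decay *)

Section spiral_geometry.
Context {R : realType} {phi : R -> R} (hphi : spiral_fun phi).
Implicit Types (a b x y : R) (z : Rcomplex R).
Local Open Scope classical_set_scope.

Lemma phi_lt x y : 0 <= x -> x < y -> phi y < phi x.
Proof.
move=> x0 xy; apply: (spiral_fun_decreasing hphi) => //.
  by rewrite in_itv/= andbT (le_trans x0)// ltW.
by rewrite in_itv/= andbT.
Qed.

Lemma phi_le x y : 0 <= x -> x <= y -> phi y <= phi x.
Proof. by move=> x0; rewrite le_eqVlt => /orP[/eqP->//|/(phi_lt x0)/ltW]. Qed.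

Lemma phi_lt_eventually e :
  0 < e -> exists2 M, 0 <= M & forall x, M <= x -> `|phi x| < e.
Proof.
move=> e0; have /cvgrPdist_lt/(_ e e0)[M [_ HM]] := spiral_fun_cvg0 hphi.
exists (Num.max 0 (M + 1)); first by rewrite le_max lexx.
move=> x; rewrite ge_max => /andP[_ Mx].
by have := HM x; rewrite sub0r normrN; apply; lra.
Qed.

Lemma phi_gt0 x : 0 <= x -> 0 < phi x.
Proof.
move=> x0; rewrite ltNge; apply/negP => phi_x.
have lt1 : phi (x + 1) < 0 by apply: lt_le_trans phi_x; apply: phi_lt => //; lra.
have [|M M0 HM] := @phi_lt_eventually (- phi (x + 1)); first by rewrite oppr_gt0.
pose y := Num.max M (x + 1).
have := HM y; rewrite /y le_max lexx => /(_ isT); rewrite ltr_norml => /andP[].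
rewrite opprK => h _; have : phi y <= phi (x + 1).
  by apply: phi_le; rewrite ?le_max ?lexx ?orbT//; lra.
by rewrite leNgt h.
Qed.

Lemma phi_le1 x : 0 <= x -> phi x <= 1.
Proof. by move=> x0; rewrite -(spiral_fun0 hphi); exact: phi_le. Qed.

Definition spiral_point a : Rcomplex R := cplx (phi a * cos a) (phi a * sin a).

Lemma spiralE :
  spiral phi = [set spiral_point a | a in `[0, +oo[ ] `|` [set 0].
Proof.
rewrite /spiral; congr (_ `|` _).
by apply: eq_imagel => a _; rewrite /spiral_point /cplx; apply/eqP;
   rewrite eq_complex /= !mul0r subr0 addr0 !eqxx.
Qed.

Lemma spiral_spiral_point a : 0 <= a -> spiral phi (spiral_point a).
Proof.
by move=> a0; rewrite spiralE; left; exists a => //=; rewrite in_itv/= a0.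
Qed.

Lemma spiral0 : spiral phi 0.
Proof. by rewrite spiralE; right. Qed.

Lemma norm_spiral_point a : 0 <= a -> `|spiral_point a| = phi a.
Proof. by move=> a0; rewrite norm_polar gtr0_norm ?phi_gt0. Qed.

(** The first term is the radial displacement, the second bounds the angular one
at the smaller radius; the factor [2] comes from bounding the two coordinates
separately. *)
Lemma spiral_point_dist a b : 0 <= a -> a <= b ->
  `|spiral_point a - spiral_point b| <= phi a - phi b + 2 * (phi b * (b - a)).
Proof.
move=> a0 ab.
have -> : spiral_point a - spiral_point b =
    cplx ((phi a - phi b) * cos a) ((phi a - phi b) * sin a) +
    cplx (phi b * (cos a - cos b)) (phi b * (sin a - sin b)).
  by rewrite cplxD cplxB; congr cplx; ring.
apply: (le_trans (ler_normD _ _)); apply: lerD.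
  by rewrite norm_polar ger0_norm// subr_ge0 phi_le.
have phib : 0 <= phi b by rewrite ltW// phi_gt0// (le_trans a0).
apply: (le_trans (norm_cplx_le _ _)).
rewrite !normrM (ger0_norm phib) -mulrDr mulrCA ler_wpM2l//.
rewrite mulr_natl mulr2n (distrC (cos a)) (distrC (sin a)).
by rewrite lerD ?cos_lipschitz ?sin_lipschitz.
Qed.

(** With [D := 2 / (1 + q)], the cut at [1 + X = s `^ (- (D / 2))] balances the
two halves: the outer arc has length of order [(1 + X) `^ (1 - q)], that is
[s `^ (1 - D)], and the rest lies in a disc of radius of order
[(1 + X) `^ (- q) = s `^ (1 - D / 2)]; both need of order [s `^ (- D)] balls. *)
Lemma covering_number_spiral_decay C q :
  0 < C -> 0 < q < 1 -> (forall x, 0 <= x -> phi x <= C * (1 + x) `^ (- q)) ->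
  exists2 K, 0 < K & forall s, 0 < s < 1 ->
    (covering_number (spiral phi) s <= (K * s `^ (- (2 / (1 + q))))%:E)%E.
Proof.
move=> C0 /andP[q0 q1] decay; pose D := 2 / (1 + q).
have q1' : 0 < 1 + q by lra.
pose k := 1 - q; have k01 : 0 < k < 1 by apply/andP; rewrite /k; split; lra.
have k0 : 0 < k by have /andP[] := k01.
pose K1 := 2 * C / k; have K10 : 0 < K1 by rewrite divr_gt0// mulr_gt0.
exists ((1 + K1) + 1 + 25 * (C + 1) ^+ 2).
  by rewrite !addr_gt0// mulr_gt0// exprn_gt0// addr_gt0.
move=> s /andP[s0 s1]; apply: covering_number_le; rewrite -/D.
have D1 : 1 < D by rewrite /D ltr_pdivlMr//; lra.
have powM u v : s `^ u * s `^ v = s `^ (u + v).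
  by rewrite powRD// (gt_eqF s0) implybT.
have powle u v : v <= u -> s `^ u <= s `^ v.
  by apply: ger_powR; rewrite s0 ltW.
have sV : s^-1 = s `^ (-1) by rewrite powR_inv1// ltW.
have s_1 : s = s `^ 1 by rewrite powRr1// ltW.
pose Y := s `^ (- (D / 2)); pose X := Y - 1.
have Y0 : 0 < Y by rewrite powR_gt0.
have X0 : 0 <= X.
  by rewrite subr_ge0 -(powRr0 s); apply: powle; lra.
have Yk : Y `^ k = s `^ (1 - D).
  by rewrite /Y -powRrM; congr (s `^ _); rewrite /D /k; field; rewrite gt_eqF.
have Yq : Y `^ (- q) = s `^ (1 - D / 2).
  by rewrite /Y -powRrM; congr (s `^ _); rewrite /D; field; rewrite gt_eqF.
pose r := (C + 1) * s `^ (1 - D / 2).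
have -> : (1 + K1 + 1 + 25 * (C + 1) ^+ 2) * s `^ (- D) =
    (1 + K1 + 1) * s `^ (- D) + 25 * (r / s) ^+ 2.
  rewrite mulrDl; congr (_ + _); rewrite -mulrA; congr (_ * _).
  rewrite /r sV -mulrA powM exprMn; congr (_ * _).
  by rewrite expr2 powM; congr (s `^ _); lra.
pose A := [set x : R | 0 <= x <= X].
(* The radial displacement plus a primitive of twice the bound on [phi]. *)
pose Phi x := 1 - phi x + K1 * ((1 + x) `^ k - 1).
have outer : coverable (spiral_point @` A) s ((1 + K1 * Y `^ k) / s + 1).
  apply: (@coverable_controlled _ _ _ _ Phi) => //.
  - by rewrite addr_ge0// mulr_ge0 ?powR_ge0// ltW.
  - move=> x /andP[x0 xX]; rewrite /Phi.
    have h1 : 1 <= (1 + x) `^ k.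
      apply: (@le_trans _ _ (1 `^ k)); first by rewrite powR1.
      by rewrite ge0_ler_powR ?nnegrE ?(ltW k0)//; lra.
    have h2 : (1 + x) `^ k <= Y `^ k.
      by rewrite ge0_ler_powR ?nnegrE ?(ltW k0) ?(ltW Y0)//; rewrite /X in xX; lra.
    have h3 : 0 <= K1 * ((1 + x) `^ k - 1) by rewrite mulr_ge0 ?subr_ge0 ?(ltW K10).
    have h4 : K1 * ((1 + x) `^ k - 1) <= K1 * Y `^ k.
      by rewrite ler_wpM2l ?(ltW K10)//; lra.
    have := phi_gt0 x0; have := phi_le1 x0.
    by move=> ? ?; apply/andP; split; lra.
  have dist_le x y : 0 <= x -> x <= y ->
      `|spiral_point x - spiral_point y| <= Phi y - Phi x.
    move=> x0 xy; apply: (le_trans (spiral_point_dist x0 xy)).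
    have y0 := le_trans x0 xy.
    have := @powR_chord _ (1 + x) (1 + y) k; rewrite (_ : k - 1 = - q); last first.
      by rewrite /k; ring.
    rewrite (_ : 1 + y - (1 + x) = y - x); last by ring.
    move=> chord; have {chord} := chord ltac:(lra) ltac:(lra) k01.
    rewrite -(ler_pM2l K10) => chord.
    have : 2 * (phi y * (y - x)) <= K1 * (k * (1 + y) `^ (- q) * (y - x)).
      rewrite /K1 !mulrA divfK ?(gt_eqF k0)// ler_wpM2r ?subr_ge0//.
      by rewrite -mulrA ler_wpM2l// decay.
    by rewrite /Phi; lra.
  move=> x y /andP[x0 _] /andP[y0 _]; rewrite ball_Rcomplex /=.
  have [xy|/ltW yx] := leP x y.
    rewrite distrC; apply: le_lt_trans.
    by rewrite (le_trans (dist_le _ _ x0 xy))// ler_norm.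
  rewrite [`|spiral_point _ - _|]distrC; apply: le_lt_trans.
  by rewrite (le_trans (dist_le _ _ y0 yx))// ler_norm.
have inner : coverable (ball (0 : Rcomplex R) r) s (25 * (r / s) ^+ 2).
  apply: coverable_ball => //; rewrite /r [leLHS]s_1.
  apply: (@le_trans _ _ (s `^ (1 - D / 2))); first by apply: powle; lra.
  by rewrite ler_peMl ?powR_ge0//; lra.
apply: (sub_coverable _ _ (coverableU outer inner)).
  move=> z; rewrite spiralE => -[[a]|->]; last first.
    by right; rewrite ball_Rcomplex /= subrr normr0 mulr_gt0 ?powR_gt0//; lra.
  rewrite /= in_itv/= andbT => a0 <-.
  have [aX|Xa] := leP a X; first by left; exists a => //=; apply/andP.
  right; rewrite ball_Rcomplex /= sub0r normrN norm_spiral_point//.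
  apply: (le_lt_trans (phi_le X0 (ltW Xa))); apply: (le_lt_trans (decay _ X0)).
  rewrite /X addrC subrK Yq /r ltr_pM2r ?powR_gt0//; lra.
rewrite lerD2r Yk mulrDl mulrDl mul1r -mulrA sV powM.
have h1 : s `^ (-1) <= s `^ (- D) by apply: powle; lra.
have h2 : 1 <= s `^ (- D) by rewrite -(powRr0 s); apply: powle; lra.
rewrite (_ : 1 - D + -1 = - D); last by ring.
by rewrite !mulrDl !mul1r !lerD.
Qed.

Lemma upper_box_dim_spiral_decay C q :
  0 < C -> 0 < q < 1 -> (forall x, 0 <= x -> phi x <= C * (1 + x) `^ (- q)) ->
  (upper_box_dim (spiral phi) <= (2 / (1 + q))%:E)%E.
Proof.
move=> C0 q01 /(covering_number_spiral_decay C0 q01)[K K0 HK].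
exact: upper_box_dim_le HK.
Qed.

(** * Gaps between consecutive turns *)

(** By [powR_step], [phi `^ (- s)] gains at least [1] with every turn, hence grows
linearly in the angle. *)
Lemma decay_of_gaps N s : 1 <= s ->
  (forall k, (N <= k)%N -> phi (2 * pi * k%:R) `^ (1 + s) <=
     phi (2 * pi * k%:R) - phi (2 * pi * k%:R + 2 * pi)) ->
  exists2 C, 0 < C & forall x, 0 <= x -> phi x <= C * (1 + x) `^ (- s^-1).
Proof.
move=> s1 gaps; have s0 : 0 < s by lra.
have pi0 : 0 < 2 * pi :> R by rewrite mulr_gt0// pi_gt0.
have x0 k : 0 <= 2 * pi * k%:R :> R by rewrite mulr_ge0// ltW.
have phi_pow_ge1 x : 0 <= x -> 1 <= phi x `^ (- s).
  move=> x_ge0; rewrite -(powRr0 (phi x)) ger_powR//; last by rewrite oppr_le0 ltW.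
  by rewrite phi_gt0//= phi_le1.
have grow j : 1 + j%:R <= phi (2 * pi * (N + j)%:R) `^ (- s).
  elim: j => [|j IH]; first by rewrite addr0 addn0 phi_pow_ge1.
  have E : 2 * pi * (N + j.+1)%:R = 2 * pi * (N + j)%:R + 2 * pi :> R.
    by rewrite addnS -(natr1 (N + j)) mulrDr mulr1.
  rewrite -(natr1 j) addrA; apply: le_trans (lerD IH (lexx 1)) _.
  rewrite E; apply: powR_step => //.
  - by rewrite phi_gt0// addr_ge0// ltW.
  - by apply: phi_le => //; lra.
  - by apply: gaps; rewrite leq_addr.
(* From the turn [N] on, [k + 1 <= (1 + N) * (1 + (k - N))]. *)
pose M := (1 + 2 * pi) * (1 + N%:R) : R.
have M0 : 0 < M by rewrite mulr_gt0 ?ltr_pwDl// ltW.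
have key x : 0 <= x -> 1 + x <= M * phi x `^ (- s).
  move=> x_ge0; pose k := Num.truncn (x / (2 * pi)).
  have := truncn_itv (divr_ge0 x_ge0 (ltW pi0)); rewrite -/k.
  rewrite ler_pdivlMr// ltr_pdivrMr// => /andP[kx xk].
  rewrite -(natr1 k) in xk.
  have xk' : 1 + x <= (1 + 2 * pi) * (1 + k%:R).
    have : 0 <= k%:R :> R by []. lra.
  have [Nk|kN] := leqP N k.
    apply: (le_trans xk'); rewrite /M -mulrA ler_wpM2l//; first by lra.
    apply: (@le_trans _ _ ((1 + N%:R) * (1 + (k - N)%:R))).
      rewrite natrB//; have : 0 <= N%:R * (k%:R - N%:R) :> R.
        by rewrite mulr_ge0// subr_ge0 ler_nat.
      lra.
    rewrite ler_wpM2l ?addr_ge0//; apply: (le_trans (grow _)).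
    rewrite subnKC// !powRN lef_pV2 ?posrE ?powR_gt0 ?phi_gt0//.
    rewrite ge0_ler_powR ?nnegrE ?(ltW s0) ?(ltW (phi_gt0 _))//.
    by apply: phi_le => //; rewrite mulrC.
  apply: (le_trans xk'); rewrite /M -mulrA ler_wpM2l//; first by lra.
  apply: (@le_trans _ _ (1 + N%:R)); first by rewrite lerD2l ler_nat ltnW.
  by rewrite ler_peMr ?phi_pow_ge1// addr_ge0.
clearbody M; exists (M `^ s^-1); first by rewrite powR_gt0.
move=> x x_ge0; have p0 := phi_gt0 x_ge0.
have h := key x x_ge0.
have -> : phi x = (phi x `^ (- s)) `^ (- s^-1).
  by rewrite -powRrM mulrNN mulfV ?gt_eqF// powRr1 ?ltW.
rewrite !powRN ler_pdivlMr ?powR_gt0//; last by lra.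
rewrite mulrC ler_pdivrMr ?powR_gt0 ?invr_gt0 ?powR_gt0//.
rewrite -powRM ?(ltW M0) ?invr_ge0 ?powR_ge0//.
rewrite ge0_ler_powR ?nnegrE ?invr_ge0 ?(ltW s0) ?mulr_ge0
  ?(ltW M0) ?invr_ge0 ?powR_ge0//.
  by lra.
by rewrite powRN in h.
Qed.

(** Among the points of the spiral on the ray through [z], take the first one of
modulus at most [|z|].  It is not on the turn [k], so its predecessor on the ray
has modulus above [|z|], and the two are one gap apart.  The point found is no
farther from the origin than [z], so that balls around the origin keep it. *)
Lemma spiral_dense_core (hmono : monotonic_winding phi) k z :
  `|z| < phi (2 * pi * k%:R + 2 * pi) ->
  exists w, [/\ spiral phi w, `|w| <= `|z| &
    `|z - w| <= phi (2 * pi * k%:R) - phi (2 * pi * k%:R + 2 * pi)].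
Proof.
move=> zk; have pi0 : 0 < 2 * pi :> R by rewrite mulr_gt0// pi_gt0.
have k0 : 0 <= 2 * pi * k%:R :> R by rewrite mulr_ge0// ltW.
have gap0 : 0 <= phi (2 * pi * k%:R) - phi (2 * pi * k%:R + 2 * pi).
  by rewrite subr_ge0 phi_le//; lra.
have [z0|zN0] := eqVneq z 0.
  by exists z; split=> //; [rewrite z0; exact: spiral0|rewrite subrr normr0].
have nz : 0 < `|z| by rewrite normr_gt0.
have [b /andP[b0 b2pi] zE] := polar_form z.
pose x j := b + 2 * pi * (k + j)%:R.
have xge j : 2 * pi * k%:R <= x j.
  rewrite /x natrD (mulrDr (2 * pi)).
  have : 0 <= 2 * pi * j%:R :> R by rewrite mulr_ge0// ltW.
  by lra.
have xS j : x j.+1 = x j + 2 * pi.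
  by rewrite /x addnS -(natr1 (k + j)) mulrDr mulr1 addrA.
have ex : exists j, phi (x j) <= `|z|.
  have [M M0 HM] := phi_lt_eventually nz.
  pose j := (Num.truncn (M / (2 * pi))).+1; exists j; rewrite ltW//.
  apply: le_lt_trans (ler_norm _) (HM _ _).
  have : M / (2 * pi) < j%:R by exact: truncnS_gt.
  rewrite ltr_pdivrMr// /x natrD => h.
  have : j%:R * (2 * pi) <= 2 * pi * (k%:R + j%:R) :> R.
    by rewrite (mulrDr (2 * pi)); lra.
  by lra.
case: (ex_minnP ex) => -[|j] phij minj.
  have := phi_le (le_trans k0 (xge 0)) (_ : x 0 <= 2 * pi * k%:R + 2 * pi).
  by rewrite {1}/x addn0 => h; have := h ltac:(lra); lra.
have zj : `|z| < phi (x j).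
  by rewrite ltNge; apply/negP => /minj; rewrite ltnn.
have x0 i : 0 <= x i by exact: le_trans (xge i).
exists (spiral_point (x j.+1)); split.
- exact: spiral_spiral_point.
- by rewrite norm_spiral_point.
rewrite [in `|z - _|]zE /spiral_point {2 4}/x cosD2piMn sinD2piMn cplxB.
rewrite -!mulrBl norm_polar.
rewrite ger0_norm ?subr_ge0// xS.
have gapj : phi (x j) - phi (x j + 2 * pi) <=
    phi (2 * pi * k%:R) - phi (2 * pi * k%:R + 2 * pi).
  have := xge j; rewrite le_eqVlt => /orP[/eqP->//|h]; apply/ltW.
  by apply: (hmono _ _ _ _ h); rewrite in_itv/= andbT.
by rewrite -xS; rewrite -xS in gapj; lra.
Qed.

Lemma covering_number_core (hmono : monotonic_winding phi) k r
    (s := phi (2 * pi * k%:R) - phi (2 * pi * k%:R + 2 * pi))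
    (t := Num.min r (phi (2 * pi * k%:R + 2 * pi))) : 0 < r ->
  ((121^-1 * (t / s) ^+ 2)%:E <=
    covering_number (ball (0%R : Rcomplex R) r `&` spiral phi) s)%E.
Proof.
move=> r0; have pi0 : 0 < 2 * pi :> R by rewrite mulr_gt0// pi_gt0.
have k0 : 0 <= 2 * pi * k%:R :> R by rewrite mulr_ge0// ltW.
apply: covering_number_dense.
- by rewrite le_min (ltW r0) ltW// phi_gt0//; lra.
- by rewrite subr_gt0 phi_lt//; lra.
move=> z; rewrite lt_min => /andP[zr zk].
have [w [Sw wz zw]] := spiral_dense_core hmono zk.
exists w => //; split=> //; rewrite ball_Rcomplex /= sub0r normrN.
exact: le_lt_trans zr.
Qed.

(** * Consequences of a box dimension above one *)

Lemma exists_dim_between (D : \bar R) b : (1 < D)%E -> (b%:E < D)%E -> b < 2 ->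
  exists d, [/\ 1 < d < 2, b < d & (d%:E < D)%E].
Proof.
move=> D1 bD b2; pose l := Num.max 1 b.
have l1 : 1 <= l by rewrite le_max lexx.
have bl : b <= l by rewrite le_max lexx orbT.
have lD : (l%:E < D)%E by rewrite /l; have [] := leP 1 b.
have l2 : l < 2 by rewrite gt_max b2 ltr1n.
move: lD; case: D {D1 bD} => [u| |]//; last first.
  by move=> _; exists ((l + 2) / 2); split; rewrite ?ltry//; lra.
rewrite lte_fin => lu; pose h := Num.min u 2.
have hu : h <= u by rewrite ge_min lexx.
have h2 : h <= 2 by rewrite ge_min lexx orbT.
have lh : l < h by rewrite lt_min lu l2.
exists ((l + h) / 2); split; rewrite ?lte_fin; lra.
Qed.


Lemma decay_fails d : 1 < d < 2 -> (d%:E < upper_box_dim (spiral phi))%E ->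
  forall C, 0 < C -> ~ (forall x, 0 <= x -> phi x <= C * (1 + x) `^ (1 - 2 / d)).
Proof.
move=> /andP[d1 d2] dim C C0 decay; have d0 : 0 < d by lra.
have q01 : 0 < 2 / d - 1 < 1.
  by rewrite subr_gt0 ltrBlDr ltr_pdivlMr// ltr_pdivrMr//; apply/andP; split; lra.
have := upper_box_dim_spiral_decay C0 q01.
rewrite opprB (_ : 2 / (1 + (2 / d - 1)) = d); last first.
  by rewrite addrC subrK invf_div mulrC divfK.
by move=> /(_ decay); rewrite leNgt dim.
Qed.

(** A negative upper limit [- e] gives [phi x <= expR (- e * x)] eventually, and
[expR (e * x) >= 1 + e * x] turns this into decay of order [(1 + x)^-1]. *)
Lemma subexponential_of_dim : (1 < upper_box_dim (spiral phi))%E ->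
  limsup_subexponential_winding phi.
Proof.
move=> dim1; have [d [d12 _ dE]] := exists_dim_between dim1 dim1 (ltr1n R 2).
have /andP[d1 d2] := d12.
apply/eqP; rewrite eq_le; apply/andP; split.
  pose V := [set x : R | 0 < x].
  apply: (@le_trans _ _ (ereal_sup [set (ln (phi x) / x)%:E | x in V])).
    apply: ereal_inf_lbound; exists V => //.
    by exists 0; split=> //; rewrite num_real.
  apply: ge_ereal_sup => _ [x x0 <-]; rewrite lee_fin.
  by rewrite mulr_le0_ge0 ?invr_ge0 ?(ltW x0)// ln_le0// phi_le1// ltW.
apply: le_ereal_inf_tmp => _ [V [M [_ MV]] <-].
rewrite leNgt; apply/negP => sup_lt0.
have [e e0 supe] : exists2 e : R, 0 < e &
    (ereal_sup [set (ln (phi x) / x)%:E | x in V] <= (- e)%:E)%E.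
  move: sup_lt0; case: (ereal_sup _) => [u| |]//= u0.
    by exists (- u); [rewrite oppr_gt0 -lte_fin|rewrite opprK].
  by exists 1; rewrite ?leNye ?ltr01.
pose m := Num.min 1 e; have m0 : 0 < m by rewrite lt_min ltr01.
pose M' := Num.max 0 M.
have M'0 : 0 <= M' by rewrite le_max lexx.
have C0 : 0 < m^-1 + (1 + M') by rewrite addr_gt0 ?invr_gt0//; lra.
apply: (@decay_fails d _ _ (m^-1 + (1 + M'))) => // x x0.
have q_ge : - 1 <= 1 - 2 / d.
  by have : 2 / d <= 2; [rewrite ler_pdivrMr; lra|lra].
have h : (1 + x)^-1 <= (1 + x) `^ (1 - 2 / d).
  by rewrite -powR_inv1 ?ler_powR//; lra.
have x1 : 0 < 1 + x by lra.
apply: (@le_trans _ _ ((m^-1 + (1 + M')) / (1 + x))); last first.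
  by rewrite ler_wpM2l// ltW.
rewrite ler_pdivlMr//; have p0 := phi_gt0 x0; have p1 := phi_le1 x0.
have m0' : 0 < m^-1 by rewrite invr_gt0.
have [xM|Mx] := leP x M'.
  apply: (@le_trans _ _ (1 + x)); last by lra.
  by rewrite ler_piMl// ltW.
have x_gt0 : 0 < x by lra.
have Vx : V x by apply: MV; apply: le_lt_trans Mx; rewrite le_max lexx orbT.
have lnx : ln (phi x) <= - e * x.
  rewrite -ler_pdivrMr// -lee_fin; apply: le_trans supe.
  by apply: ereal_sup_ubound; exists x.
have : phi x * expR (e * x) <= 1.
  by rewrite -[phi x]lnK ?posrE// -expRD -expR0 ler_expR; lra.
have : 1 + e * x <= expR (e * x) by exact: expR_ge1Dx.
have : m * (1 + x) <= 1 + e * x.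
  have m1 : m <= 1 by rewrite ge_min lexx.
  have : m * x <= e * x by rewrite ler_wpM2r// ge_min lexx orbT.
  by lra.
move=> h1 h2 h3.
have : phi x * (m * (1 + x)) <= 1.
  by apply: le_trans h3; rewrite ler_wpM2l ?(ltW p0)// (le_trans h1).
move=> h4; have : phi x * (1 + x) <= m^-1; last by lra.
by rewrite -(ler_pM2l m0) mulfV ?gt_eqF// mulrCA.
Qed.

(** With [d = 2 / (1 + q)], the exponent [2 / (2 - d)] is [1 + q^-1]: if the gaps
were larger on all late turns, [decay_of_gaps] would give the decay of order
[(1 + x) `^ (- q)] that the dimension forbids. *)
Lemma small_gap d e : 1 < d < 2 -> (d%:E < upper_box_dim (spiral phi))%E ->
  0 < e -> exists k, phi (2 * pi * k%:R) < e /\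
    phi (2 * pi * k%:R) - phi (2 * pi * k%:R + 2 * pi) <
      phi (2 * pi * k%:R) `^ (2 / (2 - d)).
Proof.
move=> /[dup] d12 /andP[d1 d2] dim e0; have d0 : 0 < d by lra.
have pi0 : 0 < 2 * pi :> R by rewrite mulr_gt0// pi_gt0.
have [M M0 HM] := phi_lt_eventually e0.
pose s := d / (2 - d); have s1 : 1 <= s by rewrite ler_pdivlMr; lra.
apply: contrapT => /forallNP no_k.
have [k Nk|C C0 decay] := @decay_of_gaps (Num.truncn (M / (2 * pi))).+1 s s1.
  rewrite leNgt; apply/negP => gap; apply: (no_k k); split.
    apply: le_lt_trans (ler_norm _) (HM _ _).
    have : M / (2 * pi) < k%:R.
      by apply: lt_le_trans (truncnS_gt _) _; rewrite ler_nat.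
    by rewrite ltr_pdivrMr// mulrC => /ltW.
  rewrite (_ : 2 / (2 - d) = 1 + s)//.
  by rewrite /s; field; rewrite gt_eqF// subr_gt0.
apply: (decay_fails d12 dim C0) => x x0.
rewrite (_ : 1 - 2 / d = - s^-1); first exact: decay.
by rewrite /s invf_div; field; rewrite gt_eqF.
Qed.

(** The balls are centred at the origin, with [r ^ (1 / theta)] equal to
the gap of a turn given by [small_gap].  Both cases, [r] below or above the
radius of the filled disc, are treated at once through
[s `^ e1 <= 2 * min r (p - s)]. *)
Lemma assouad_spectrum_ge (hmono : monotonic_winding phi) theta a d :
  0 < theta < 1 -> 1 < d < 2 -> (d%:E < upper_box_dim (spiral phi))%E ->
  a < 2 -> a * (1 - theta) < d ->
  forall C rho, 0 < C -> 0 < rho -> exists r (z : Rcomplex R),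
   [/\ 0 < r <= rho, spiral phi z &
     ((C * (r / r `^ theta^-1) `^ a)%:E <
      covering_number (ball z r `&` spiral phi) (r `^ theta^-1))%E].
Proof.
move=> /andP[t0 t1] /[dup] d12 /andP[d1 d2] dim a2 ad C rho C0 rho0.
have pi0 : 0 < 2 * pi :> R by rewrite mulr_gt0// pi_gt0.
pose e1 := Num.max theta (1 - d / 2).
have e1t : theta <= e1 by rewrite le_max lexx.
have e1d : 1 - d / 2 <= e1 by rewrite le_max lexx orbT.
pose eta := (1 - theta) * (- a) - 2 * (e1 - 1).
have eta0 : 0 < eta.
  have h : a * (1 - theta) < 2 * (1 - theta) by rewrite ltr_pM2r// subr_gt0.
  by rewrite /eta /e1; have [] := leP theta (1 - d / 2) => _; lra.
have [K KE] : exists K, K = 484 * C by exists (484 * C).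
have K0 : 0 < K by rewrite KE; lra.
(* [1 / 2] makes the gap at most half of the radius [p], the second bound gives
   [r <= rho], and the third one absorbs [C] and the factor [1 / 484], which is
   [1 / 121] from the grid times [1 / 4] from halving the radius. *)
pose bound := Num.min (1 / 2) (Num.min (rho `^ theta^-1) (K `^ (- eta^-1))).
have bound0 : 0 < bound by rewrite !lt_min !powR_gt0// divr_gt0.
have [k [pk gap]] := small_gap d12 dim bound0.
move: pk; rewrite !lt_min => /and3P[p_half p_rho p_C].
have k0 : 0 <= 2 * pi * k%:R :> R by rewrite mulr_ge0// ltW.
move: (covering_number_core hmono k) => core.
have p0 := phi_gt0 k0.
have s0 : 0 < phi (2 * pi * k%:R) - phi (2 * pi * k%:R + 2 * pi).
  by rewrite subr_gt0 phi_lt//; lra.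
have p'E : phi (2 * pi * k%:R + 2 * pi) = phi (2 * pi * k%:R) -
   (phi (2 * pi * k%:R) - phi (2 * pi * k%:R + 2 * pi)) by ring.
move: p'E core gap s0 p0 p_half p_rho p_C.
set s := phi _ - phi _; set p := phi (2 * pi * k%:R); set p' := phi _.
move=> -> {p'} core gap s0 p0 p_half p_rho p_C.
have pow2 : p `^ (2 / (2 - d)) <= p / 2.
  have e2 : 2 <= 2 / (2 - d) by rewrite ler_pdivlMr; lra.
  apply: (@le_trans _ _ (p `^ 2)).
    by apply: ger_powR => //; rewrite p0/=; lra.
  by rewrite powR_mulrn ?(ltW p0)// expr2 ler_wpM2l ?(ltW p0)//; lra.
have s_half : s < p / 2 by exact: lt_le_trans pow2.
have powM u v : s `^ u * s `^ v = s `^ (u + v).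
  by rewrite powRD// (gt_eqF s0) implybT.
have s1 : s <= 1 by lra.
have powle u v : v <= u -> s `^ u <= s `^ v by apply: ger_powR; rewrite s0.
have sV : s^-1 = s `^ (-1) by rewrite powR_inv1// ltW.
have p_ge : s `^ (1 - d / 2) <= p.
  have -> : p = (p `^ (2 / (2 - d))) `^ (1 - d / 2).
    rewrite -powRrM (_ : _ * _ = 1) ?powRr1 ?(ltW p0)//.
    by field; rewrite gt_eqF// subr_gt0.
  by rewrite ge0_ler_powR ?nnegrE ?powR_ge0 ?(ltW s0) ?(ltW gap)//; lra.
pose r := s `^ theta; have r0 : 0 < r by rewrite powR_gt0.
have rE : r `^ theta^-1 = s by rewrite /r -powRrM mulfV ?gt_eqF// powRr1 ?ltW.
exists r, 0; split.
- rewrite r0 /=; have -> : rho = (rho `^ theta^-1) `^ theta.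
    by rewrite -powRrM mulVf ?gt_eqF// powRr1 ?ltW.
  by rewrite ge0_ler_powR ?nnegrE ?powR_ge0 ?(ltW s0) ?(ltW t0)//; lra.
- exact: spiral0.
rewrite rE; apply: lt_le_trans (core r r0); rewrite lte_fin.
have t_ge : s `^ e1 / 2 <= Num.min r (p - s).
  rewrite le_min; apply/andP; split.
    have : s `^ e1 <= r by apply: powle.
    by have := powR_ge0 s e1; lra.
  have : s `^ e1 <= p by apply: le_trans p_ge; apply: powle.
  by lra.
have -> : (r / s) `^ a = s `^ ((1 - theta) * (- a)).
  by rewrite /r sV powM -powRrM; congr (s `^ _); ring.
have ratio : s `^ (2 * (e1 - 1)) / 4 <= (Num.min r (p - s) / s) ^+ 2.
  have -> : s `^ (2 * (e1 - 1)) / 4 = (s `^ e1 / 2 / s) ^+ 2.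
    rewrite mulrAC sV powM expr_div_n expr2 powM; congr (s `^ _ / _); ring.
  rewrite lerXn2r ?nnegrE ?divr_ge0 ?powR_ge0 ?(ltW s0)//.
    by rewrite le_min (ltW r0); lra.
  by rewrite ler_wpM2r ?invr_ge0 ?(ltW s0).
apply: (@lt_le_trans _ _ (121^-1 * (s `^ (2 * (e1 - 1)) / 4))); last first.
  by rewrite ler_wpM2l.
have -> : s `^ ((1 - theta) * (- a)) = s `^ eta * s `^ (2 * (e1 - 1)).
  by rewrite powM; congr (s `^ _); rewrite /eta; ring.
have : K * s `^ eta < 1.
  have sC : s < K `^ (- eta^-1) by lra.
  have : s `^ eta < (K `^ (- eta^-1)) `^ eta.
    by rewrite gt0_ltr_powR ?nnegrE ?powR_ge0 ?(ltW s0).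
  rewrite -powRrM mulNr mulVf ?gt_eqF// powR_inv1 ?(ltW K0)//.
  by rewrite -ltr_pdivlMl// mulr1.
have pos : 0 < s `^ (2 * (e1 - 1)) by rewrite powR_gt0.
rewrite -(ltr_pM2r pos) mul1r KE; set u := s `^ eta; set v := s `^ _.
by lra.
Qed.

End spiral_geometry.

Theorem theorem7p2 (R : realType) (phi : R -> R)
    (hphi : spiral_fun phi)
    (hconv : convex_differentiable phi)
    (hmono : monotonic_winding phi)
    (hdim : (1%:E < upper_box_dim (spiral phi))%E) :
  (forall theta : R, 0 < theta < 1 ->
     assouad_spectrum theta (spiral phi)
     = Order.min (upper_box_dim (spiral phi) / (1 - theta)%:E)%E 2%:E)
  /\ limsup_subexponential_winding phi.
Proof.
split; last exact: subexponential_of_dim.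
move=> theta /[dup] t01 /andP[t0 t1]; have t1' : 0 < 1 - theta by rewrite subr_gt0.
apply/eqP; rewrite eq_le; apply/andP; split.
  rewrite le_min assouad_spectrum_le2// andbT assouad_spectrum_le_box//.
  by apply: lt_trans hdim; rewrite lte_fin.
apply: le_ereal_inf_tmp => _ [a [C [rho [C0 rho0 cover]]] <-].
rewrite leNgt; apply/negP; rewrite lt_min lte_fin => /andP[a_dim a2].
have [d [d12 ad dE]] : exists d : R,
    [/\ 1 < d < 2, a * (1 - theta) < d & (d%:E < upper_box_dim (spiral phi))%E].
  apply: exists_dim_between => //.
    by move: a_dim; rewrite inver gt_eqF// lte_pdivlMr// EFinM.
  have [a0|a0] := leP 0 a; last first.
    by have := nmulr_rlt0 (1 - theta) a0; rewrite t1'; lra.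
  by apply: le_lt_trans a2; rewrite ler_piMr//; lra.
have [r [z [r_rho Sz]]] := assouad_spectrum_ge hphi hmono t01 d12 dE a2 ad C0 rho0.
by rewrite ltNge cover.
Qed.
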